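(* Let $A$ and $B$ be positive-definite self-adjoint operators in a separable complex Hilbert space $\mathfrak{H}$ with $\mathcal{D}(A)=\mathcal{D}(B)$, where $A$ has discrete spectrum and $B$ has discrete simple spectrum $\lambda_1<\lambda_2<\cdots$ and an orthonormal basis of eigenvectors $\{e_k\}_{k=1}^\infty$, $Be_k=\lambda_ke_k$. Let $x\in\mathcal{D}(A)$ be the solution of $Ax=y$ with $y\in\mathfrak{H}$, and let $x_n$ be its Ritz approximate solution with respect to the coordinate system $\{e_k\}_{k=1}^{\infty}$. If $x\in\mathcal{D}(B^\alpha)$ with $\alpha\ge1$, then for every $k\in\mathbb{N}=\{1,2,\dots\}$ and every $n\in\mathbb{N}$ $$\|x-x_n\|_+\le \mathbf{c}_0\,\frac{\sqrt{k+1}}{2^k\,\lambda_{n+1}^{\alpha-\frac12}}\;\omega_k\left(\frac{\pi}{\lambda_{n+1}},B^\alpha x,B\right),$$ where $\mathbf{c}_0=\mathbf{c}_2\mathbf{c}_3$, $\mathbf{c}_2=\|A^{1/2}B^{-1/2}\|$ and $\mathbf{c}_3=\|B^{1/2}A^{-1/2}\|\,\|A^{1/2}B^{-1/2}\|$.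
   Context: Positive definite means $(Az,z)\ge\gamma\|z\|^2$ on $\mathcal{D}(A)$ for some $\gamma>0$ (similarly for $B$). Discrete spectrum means that the spectrum consists of isolated eigenvalues of finite multiplicity. Since $\mathcal{D}(A)=\mathcal{D}(B)$, the Heinz inequality gives $\mathcal{D}(A^{1/2})=\mathcal{D}(B^{1/2})$, and the operators $B^{1/2}A^{-1/2}$ and $A^{1/2}B^{-1/2}$ are bounded on $\mathfrak{H}$. The energy norm is $\|z\|_+=(Az,z)^{1/2}$ for $z\in\mathcal{D}(A)$ (that is, $\|z\|_+=\|A^{1/2}z\|$). Ritz approximate solution: $x_n$ is the vector at which the functional $F(z)=(Az,z)-2\,\mathrm{Re}\,(y,z)$ attains its minimum on $\mathcal{H}_n=\mathrm{span}\{e_1,\dots,e_n\}$. Modulus of continuity: with $U(h)=\exp(ihB)$ and $\Delta_h^k=(U(h)-\mathbb{I})^k$, $\omega_k(t,z,B)=\sup_{0<\tau\le t}\|\Delta_\tau^kz\|$ for $t>0$, $k\in\mathbb{N}$, $z\in\mathfrak{H}$. *)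

(* Defs.v *)
From HB Require Import structures.
From mathcomp Require Import all_boot all_order all_algebra.
From mathcomp Require Import complex.
From mathcomp Require Import all_classical all_reals all_analysis.

Set Implicit Arguments.
Unset Strict Implicit.
Unset Printing Implicit Defensive.

Import Order.TTheory GRing.Theory Num.Theory.
Import numFieldNormedType.Exports.

Local Open Scope classical_set_scope.
Local Open Scope complex_scope.
Local Open Scope ring_scope.

(* A complex Hilbert space is a complete normed space over R[i] with an inner
   product (linear on the left, antilinear on the right) inducing its norm. *)
Definition induces_norm (R : realType) (H : normedModType R[i])
    (dot : {dot H for Num.conj}) : Prop :=
  forall z : H, `|z| ^+ 2 = dot z z.

Definition separable (T : topologicalType) : Prop :=
  exists2 D : set T, countable D & dense D.

(* The norm of a normedModType over R[i] takes its values in R[i];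
   hnorm is the same number as an element of R. *)
Definition hnorm (R : realType) (H : normedModType R[i]) (z : H) : R :=
  complex.Re `|z|.

(* A partially defined operator: only the values on opdom are meaningful. *)
Record operator (V : Type) := Operator { opdom : set V; opfun :> V -> V }.

Section Operators.
Variables (R : realType) (H : normedModType R[i]).
Implicit Types (S T : operator H) (mu : R[i]).

Definition linear_op T : Prop :=
  opdom T 0 /\
  forall (a : R[i]) (u v : H), opdom T u -> opdom T v ->
    opdom T (a *: u + v) /\ T (a *: u + v) = a *: T u + T v.

Definition eq_op S T : Prop :=
  opdom S = opdom T /\ forall z, opdom T z -> S z = T z.

Definition comp_op S T : operator H :=
  Operator [set z | opdom T z /\ opdom S (T z)] (fun z => S (T z)).

(* Meaningful for T injective on its domain. *)
Definition inv_op T : operator H :=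
  Operator (T @` opdom T) (fun w => xget 0 [set z | opdom T z /\ T z = w]).

(* For an unbounded T the supremum takes the default value 0. *)
Definition opnorm T : R :=
  sup [set hnorm (T z) | z in [set z | opdom T z /\ hnorm z <= 1]].

Definition eigenspace_op T mu : set H := [set v | opdom T v /\ T v = mu *: v].

Definition eigenvalue_op T mu : Prop := exists2 v, eigenspace_op T mu v & v != 0.

Definition span n (e : 'I_n -> H) : set H :=
  [set z | exists c : 'I_n -> R[i], z = \sum_(i < n) c i *: e i].

Definition resolvent_set T : set R[i] :=
  [set mu |
    (forall w : H, exists! z, opdom T z /\ T z - mu *: z = w) /\
    exists M : R, forall z, opdom T z ->
      hnorm z <= M * hnorm (T z - mu *: z)].

Definition spectrum T : set R[i] := ~` resolvent_set T.

Definition finite_multiplicity T mu : Prop :=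
  exists n, exists e : 'I_n -> H, eigenspace_op T mu `<=` span e.

Definition discrete_spectrum T : Prop :=
  forall mu, spectrum T mu ->
    [/\ isolated (spectrum T : set R[i]^o) mu, eigenvalue_op T mu
      & finite_multiplicity T mu].

Definition simple_eigenvalue T mu : Prop :=
  exists2 v : H, v != 0 & eigenspace_op T mu = [set a *: v | a in setT].

End Operators.

Section InnerProduct.
Variables (R : realType) (H : normedModType R[i]) (dot : {dot H for Num.conj}).
Implicit Types (S T : operator H) (e : nat -> H) (lam : nat -> R).

(* v lies in the domain of the adjoint of T, with value w. *)
Definition adjoint_graph T (v w : H) : Prop :=
  forall u, opdom T u -> dot (T u) v = dot u w.

Definition self_adjoint T : Prop :=
  [/\ linear_op T, dense (opdom T)
    & forall v w, adjoint_graph T v w <-> opdom T v /\ T v = w].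

Definition positive_op T : Prop := forall z, opdom T z -> 0 <= dot (T z) z.

Definition positive_definite T : Prop :=
  exists2 gamma : R, 0 < gamma
    & forall z, opdom T z -> gamma%:C * `|z| ^+ 2 <= dot (T z) z.

(* S is the nonnegative self-adjoint square root of T, which exists and is
   unique whenever T is self-adjoint and nonnegative. *)
Definition is_sqrt_op T S : Prop :=
  [/\ self_adjoint S, positive_op S & eq_op (comp_op S S) T].

Definition orthonormal_basis e : Prop :=
  (forall i j, dot (e i) (e j) = (i == j)%:R) /\
  forall z, series (fun k => dot z (e k) *: e k) @ \oo --> z.

(* f(B) for a self-adjoint B whose eigenvectors e form an orthonormal basis,
   with B (e k) = lam k e k.  As H is complete and e orthonormal, the series
   converges iff the squares of the moduli of its coefficients are summable. *)
Definition spectral_op e lam (f : R -> R[i]) : operator H :=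
  let s z : H ^nat :=
    series (fun k => (f (lam k) * dot z (e k)) *: e k) in
  Operator [set z | cvgn (s z)] (fun z => limn (s z)).

Definition pow_op e lam (alpha : R) : operator H :=
  spectral_op e lam (fun s => (s `^ alpha)%:C).

Definition exp_op e lam (h : R) : operator H :=
  spectral_op e lam (fun s => cos (h * s) +i* sin (h * s)).

Definition diff_op e lam (h : R) (k : nat) (z : H) : H :=
  iter k (fun v => exp_op e lam h v - v) z.

Definition omega e lam (k : nat) (t : R) (z : H) : R :=
  sup [set hnorm (diff_op e lam tau k z) | tau in [set tau | 0 < tau <= t]].

Definition energy_norm T (z : H) : R := Num.sqrt (complex.Re (dot (T z) z)).

Definition ritz_functional T (y z : H) : R :=
  complex.Re (dot (T z) z) - 2 * complex.Re (dot y z).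

Definition ritz_solution T (y : H) e (n : nat) (xn : H) : Prop :=
  let Hn := span (fun i : 'I_n => e i) in
  Hn xn /\ forall z, Hn z -> ritz_functional T y xn <= ritz_functional T y z.

End InnerProduct.

(* Main.v *)
Require Import Defs.
From mathcomp Require Import all_boot all_order all_algebra.
From mathcomp Require Import complex.
From mathcomp Require Import all_classical all_reals all_analysis.
From mathcomp Require Import ring lra.
Import Order.TTheory GRing.Theory Num.Theory.
Import numFieldNormedType.Exports.
Local Open Scope classical_set_scope.
Local Open Scope complex_scope.
Local Open Scope ring_scope.

Set Implicit Arguments.
Unset Strict Implicit.
Unset Printing Implicit Defensive.

(** Write S and T for the square roots of A and B, and p for the n-th partial
    sum of the expansion of x in the eigenbasis of B.

    The Ritz solution minimizes the energy distance to x over the span of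
    e 0, ..., e (n-1), and p lies in that span, so it suffices to bound the
    energy norm of w = x - p, which is the norm of S w.  Passing from S w to
    T w costs one factor c2.  The remaining factor c3 is at least 1, as one
    sees by going from T to S and back on a nonzero vector.

    For this the two operator norms must be genuine bounds: opnorm is a
    supremum and says nothing about an unbounded operator.  That S T^-1 and
    T S^-1 are bounded is the Heinz inequality, proved in three stages.  By the
    Hellinger-Toeplitz principle A B^-1 is bounded, i.e. |A z| <= C |B z|
    (relatively_bounded).  The operator K = B^-1 A is symmetric for the form
    (B u, v); iterating Cauchy-Schwarz for that form on the powers K^(2^j) turns
    the operator bound into the form bound (A z, z) <= C (B z, z)
    (form_bounded), that is |S z| <= sqrt C |T z| on the domain of A.  Finally
    a duality argument extends this to all vectors on which S and T are defined
    (heinz).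

    There remains a question about B alone (hnorm_sqrt_tail_le).  The
    coefficients of T w vanish below n, and beyond n they are those of
    B^alpha x times lam j ^ (1/2 - alpha), which is at most
    lam n ^ (1/2 - alpha).  So it is enough to bound the tail of
    z = B^alpha x by its modulus of continuity (jackson).  The squared modulus
    of the j-th coefficient of Delta_tau^k z is
    2^k (1 - cos (tau lam j))^k |z_j|^2.  Integrating against
    sin (lam n tau) over tau in [0, pi / lam n], everything reduces to
      int_0^pi (1 - cos (s t))^k sin t dt >= 2^(k+1) / (k+1)   for s >= 1,
    which holds with equality at s = 1 and follows by induction on k from two
    integrations by parts. *)

(** * A weighted integral of powers of 1 - cos *)

Lemma is_derive_cosM (R : realType) (s t : R) :
  is_derive t 1 (fun u => cos (s * u)) (- (s * sin (s * t))).
Proof.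
apply: (@is_derive_eq _ _ _ (cos \o (fun u => s * u))).
by rewrite /GRing.scale /=; ring.
Qed.

Lemma is_derive_sinM (R : realType) (s t : R) :
  is_derive t 1 (fun u => sin (s * u)) (s * cos (s * t)).
Proof.
apply: (@is_derive_eq _ _ _ (sin \o (fun u => s * u))).
by rewrite /GRing.scale /=; ring.
Qed.

Lemma pow_one_sub_cos_le (R : realType) (x : R) k : (1 - cos x) ^+ k <= 2 ^+ k.
Proof.
apply: lerXn2r; rewrite ?nnegrE ?subr_ge0 ?cos_le1//.
by rewrite lerBlDr -lerBlDl; apply: le_trans (cos_geN1 x); lra.
Qed.

Lemma is_derive_pow_one_sub_cos (R : realType) (s t : R) n :
  is_derive t 1 (fun u => (1 - cos (s * u)) ^+ n.+1)
    (n.+1%:R * (1 - cos (s * t)) ^+ n * (s * sin (s * t))).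
Proof.
have dc := is_derive_cosM s t.
have d1 : is_derive t 1 (cst 1 - (fun u => cos (s * u))) (s * sin (s * t)).
  by apply: is_derive_eq; rewrite sub0r opprK.
have := is_deriveX n.+1 d1.
by rewrite (_ : (_ ^+ _) = fun u => (1 - cos (s * u)) ^+ n.+1)// fctE.
Qed.

(** The integral I k of (1 - cos (s t))^k sin t over [0, pi], expressed through
    an antiderivative.  The second derivative of (1 - cos)^k is
    k (2k-1) (1 - cos)^(k-1) - k^2 (1 - cos)^k, so integrating by parts twice
    gives
      (s^2 k^2 - 1) I k = s^2 k (2k-1) I (k-1) - (1 - cos (s pi))^k,
    and the last term is at most 2^k.  Inserting I (k-1) >= 2^k / k, the claim
    for k becomes (k-1) (s^2 - 1) >= 0.  The induction starts at k = 1 because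
    for k = 1 and s = 1 the left-hand factor vanishes. *)
Lemma pow_one_sub_cos_sin_antiderivative (R : realType) (s : R) (k : nat) : 1 <= s ->
  exists F : R -> R,
    (forall t : R, is_derive t 1 F ((1 - cos (s * t)) ^+ k.+1 * sin t)) /\
    2 ^+ k.+2 / k.+2%:R <= F pi - F 0.
Proof.
move=> s1; have s0 : 0 < s by lra.
elim: k => [|k [F [dF IF]]].
  have [->|sn1] := eqVneq s 1.
    exists (fun t : R => 2^-1 * ((1 - cos t) * (1 - cos t))); split.
      move=> t; apply: is_derive_eq; rewrite /GRing.scale /=.
      by rewrite mul1r expr1; field.
    by rewrite cospi cos0; lra.
  have {}s1 : 1 < s by rewrite lt_neqAle eq_sym sn1.
  have d0 : 0 < s ^+ 2 - 1 by nra.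
  exists (fun t : R => - cos t - (s ^+ 2 - 1)^-1 *
    (cos (s * t) * cos t + s * (sin (s * t) * sin t))); split.
    move=> t.
    have := is_derive_cosM s t; have := is_derive_sinM s t => ? ?.
    apply: is_derive_eq; rewrite /GRing.scale /=.
    by field; rewrite gt_eqF.
  rewrite mulr0 cospi cos0 sinpi !sin0.
  have c1 := cos_geN1 (s * pi).
  rewrite -subr_ge0 (_ : _ - _ = (s ^+ 2 - 1)^-1 * (cos (s * pi) + 1)).
    by apply: mulr_ge0; [rewrite invr_ge0 ltW|lra].
  by field; rewrite gt_eqF.
pose K : R := k.+2%:R.
have K2 : 2 <= K by rewrite /K (ler_nat _ 2).
have KE : k.+2%:R = K by [].
clearbody K.
have d0 : 0 < s ^+ 2 * K ^+ 2 - 1.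
  have : K ^+ 2 <= s ^+ 2 * K ^+ 2.
    by rewrite ler_peMl ?sqr_ge0// expr_ge1// ltW.
  have : 4 <= K ^+ 2 by have : 0 <= (K - 2) ^+ 2 := sqr_ge0 _; lra.
  by lra.
(* W is the boundary term of the two integrations by parts. *)
pose W (t : R) := - ((1 - cos (s * t)) ^+ k.+2 * cos t) +
  s * K * ((1 - cos (s * t)) ^+ k.+1 * (sin (s * t) * sin t)).
exists (fun t : R => (s ^+ 2 * K ^+ 2 - 1)^-1 *
   (s ^+ 2 * K * (2 * K - 1) * F t - W t)); split.
  move=> t.
  have dS := is_derive_sinM s t.
  have dP := is_derive_pow_one_sub_cos s t k.+1.
  have dQ := is_derive_pow_one_sub_cos s t k.
  have dW := is_deriveD (is_deriveN (is_deriveM dP (is_derive_cos t)))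
    (is_deriveZ (s * K) (is_deriveM dQ (is_deriveM dS (is_derive_sin t)))).
  have dFW := is_deriveZ (s ^+ 2 * K ^+ 2 - 1)^-1
    (is_deriveB (is_deriveZ (s ^+ 2 * K * (2 * K - 1)) (dF t)) dW).
  apply: (is_derive_eq dFW); rewrite /GRing.scale /=.
  apply: (@mulfI _ (s ^+ 2 * K ^+ 2 - 1)); first by rewrite gt_eqF.
  rewrite mulrA divff ?gt_eqF// mul1r.
  set c := cos (s * t); set S := sin (s * t).
  have S2 : S * S = (1 - c) * (1 + c).
    by rewrite -expr2 /S sin2cos2 -/c; ring.
  have K1 : k.+1%:R = K - 1 by rewrite -KE -[k.+2%:R]natr1 addrK.
  rewrite !KE K1 /= !exprS expr0.
  change (((fun u : R => sin (s * u)) * sin) t) with (S * sin t).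
  move: ((1 - c) ^+ k) => p.
  transitivity (s ^+ 2 * K * (2 * K - 1) * (1 - c) * p * sin t
    + (1 - c) ^+ 2 * p * - sin t - s ^+ 2 * K * c * (1 - c) * p * sin t
    - s ^+ 2 * K * (K - 1) * p * sin t * (S * S)); first by ring.
  by rewrite S2; ring.
rewrite /W cospi sinpi !mulr0 !cos0 !sin0 !mulr0 addr0.
rewrite subrr expr0n /= mul0r oppr0 addr0 subr0 mulrN1 opprK -mulrBr.
have PB := pow_one_sub_cos_le (s * pi) k.+2.
have q0 : 0 < 2 ^+ k.+2 :> R by rewrite exprn_gt0.
rewrite -[k.+3%:R]natr1 KE exprS; rewrite KE in IF.
move: ((1 - _) ^+ _) (2 ^+ k.+2) q0 PB IF => P q q0 PB.
rewrite ler_pdivrMr; last by lra.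
move=> IF; rewrite ler_pdivrMr; last by lra.
rewrite -[leRHS]mulrA ler_pdivlMl//.
have h1 : s ^+ 2 * (2 * K - 1) * q <= s ^+ 2 * (2 * K - 1) * ((F pi - F 0) * K).
  by apply: ler_wpM2l IF; apply: mulr_ge0; [exact: sqr_ge0|lra].
have h2 : 0 <= q * ((s ^+ 2 - 1) * (K - 1)).
  apply: mulr_ge0; first exact: ltW.
  by apply: mulr_ge0; [rewrite subr_ge0 expr_ge1// ltW|lra].
have h3 : (s ^+ 2 * (2 * K - 1) * q - q) * (K + 1) <=
   (s ^+ 2 * (2 * K - 1) * ((F pi - F 0) * K) - P) * (K + 1).
  by apply: ler_wpM2r; lra.
lra.
Qed.

(** Averaging a bound over t against sin t / 2.  Instead of integrating, one
    compares endpoint values: G is an antiderivative of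
    (sum - M) sin, hence nonincreasing on [0, pi]. *)
Lemma sum_le_of_trig_bound (R : realType) (N k : nat) (s a : nat -> R) (M : R) :
  (forall j, (j < N)%N -> 1 <= s j) -> (forall j, 0 <= a j) ->
  (forall t, 0 < t <= pi -> \sum_(j < N) a j * (1 - cos (s j * t)) ^+ k.+1 <= M) ->
  \sum_(j < N) a j * (2 ^+ k.+1 / k.+2%:R) <= M.
Proof.
move=> s1 a0 hM.
have [F HF] := choice (fun j : 'I_N =>
  pow_one_sub_cos_sin_antiderivative k (s1 _ (ltn_ord j))).
pose G : R -> R := M \*: cos + \sum_(j < N) a j \*: F j.
pose dG (t : R) : R := M *: - sin t
   + \sum_(j < N) a j *: ((1 - cos (s j * t)) ^+ k.+1 * sin t).
have hG (t : R) : is_derive t 1 G (dG t).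
  apply: is_deriveD; apply: is_derive_sum => j.
  by apply: is_deriveZ; case: (HF j).
have [c] := MVT (pi_gt0 R) (fun x _ => hG x)
  (derivable_within_continuous (fun x _ => @ex_derive _ _ _ _ _ _ _ (hG x))).
rewrite in_itv /= => /andP[c0 cpi] GE.
have dGc : dG c * (pi - 0) <= 0.
  rewrite subr0; apply: mulr_le0_ge0; last exact: pi_ge0.
  have -> : dG c = (\sum_(j < N) a j * (1 - cos (s j * c)) ^+ k.+1 - M) * sin c.
    rewrite /dG /GRing.scale /= mulrBl mulr_suml mulrN addrC; congr (_ - _).
    by apply: eq_bigr => j _; rewrite mulrA.
  apply: mulr_le0_ge0; first by rewrite subr_le0 hM// c0 ltW.
  by rewrite sin_ge0_pi// !ltW.
have GxE x : G x = M * cos x + \sum_(j < N) a j * F j x.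
  transitivity (M * cos x + (\sum_(j < N) a j \*: F j) x); first by [].
  by rewrite fct_sumE.
have : \sum_(j < N) a j * (2 ^+ k.+2 / k.+2%:R) <=
    \sum_(j < N) a j * F j pi - \sum_(j < N) a j * F j 0.
  rewrite -sumrB; apply: ler_sum => j _; rewrite -mulrBr.
  by apply: ler_wpM2l => //; case: (HF j).
rewrite -!mulr_suml exprS -mulrA [X in X <= _]mulrCA.
rewrite -GE !GxE cospi cos0 in dGc.
move: (_ * (2 ^+ k.+1 / _)) dGc => X; lra.
Qed.

(** * Complex scalars *)

(** The modulus as a real number, parallel to hnorm on vectors. *)
Definition cmod (R : realType) (a : R[i]) : R := complex.Re `|a|.

Lemma cmodE (R : realType) (a : R[i]) : (cmod a)%:C = `|a|.
Proof. by rewrite /cmod RRe_real// normr_real. Qed.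

Lemma cmod_ge0 (R : realType) (a : R[i]) : 0 <= cmod a.
Proof. by rewrite -ler0c cmodE. Qed.

Lemma cmodM (R : realType) (a b : R[i]) : cmod (a * b) = cmod a * cmod b.
Proof. by apply: complexI; rewrite rmorphM /= !cmodE normrM. Qed.

Lemma cmodr (R : realType) (r : R) : cmod r%:C = `|r|.
Proof. by rewrite /cmod normc_def /= expr0n addr0 sqrtr_sqr. Qed.

Lemma ReZ (R : realType) (r : R) (a : R[i]) : complex.Re (r%:C * a) = r * complex.Re a.
Proof. by case: a => a b; rewrite /= mul0r subr0. Qed.

Lemma ReD (R : realType) (a b : R[i]) : complex.Re (a + b) = complex.Re a + complex.Re b.
Proof. by case: a; case: b. Qed.

Lemma conjCr (R : realType) (r : R) : (r%:C)^* = r%:C.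
Proof. by rewrite conj_Creal// complex_real. Qed.

(** * Norm and inner product *)

Section HilbertBasics.
Variables (R : realType) (H : normedModType R[i]).
Implicit Types (u v w z : H) (a : R[i]).

Lemma hnormE z : (hnorm z)%:C = `|z|.
Proof. by rewrite /hnorm RRe_real// normr_real. Qed.

Lemma hnorm_ge0 z : 0 <= hnorm z.
Proof. by rewrite -ler0c hnormE. Qed.

Lemma hnorm0 : hnorm (0 : H) = 0.
Proof. by apply: complexI; rewrite hnormE normr0. Qed.

Lemma hnorm_eq0 z : (hnorm z == 0) = (z == 0).
Proof. by rewrite -[RHS]normr_eq0 -hnormE eq_complex /= eqxx andbT. Qed.

Lemma hnormD u v : hnorm (u + v) <= hnorm u + hnorm v.
Proof. by rewrite -lecR rmorphD /= !hnormE ler_normD. Qed.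

Lemma hnormN u : hnorm (- u) = hnorm u.
Proof. by rewrite /hnorm normrN. Qed.

Lemma hnormB u v : hnorm (u - v) <= hnorm u + hnorm v.
Proof. by rewrite -(hnormN v) hnormD. Qed.

Lemma hnormZ a z : (hnorm (a *: z))%:C = `|a| * (hnorm z)%:C.
Proof. by rewrite !hnormE normrZ. Qed.

Lemma hnormZr (r : R) z : hnorm (r%:C *: z) = `|r| * hnorm z.
Proof.
apply: complexI; rewrite hnormZ rmorphM /=; congr (_ * _).
by rewrite normc_def /= expr0n addr0 sqrtr_sqr.
Qed.

Lemma cvg_hnormP (u : nat -> H) l :
  u @ \oo --> l <-> forall eps : R, 0 < eps -> \forall n \near \oo, hnorm (l - u n) < eps.
Proof.
split=> [/cvgrPdist_lt ul eps e0|ul].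
  have := ul eps%:C; rewrite ltcR => /(_ e0).
  by apply: filterS => n; rewrite -hnormE ltcR.
apply/cvgrPdist_lt => eps e0.
have er : (complex.Re eps)%:C = eps by rewrite RRe_real// gtr0_real.
have := ul (complex.Re eps); rewrite -ltcR er => /(_ e0).
by apply: filterS => n; rewrite -hnormE -ltcR er.
Qed.

Lemma dense_approx (D : set H) w (eps : R) : dense D -> 0 < eps ->
  exists2 v, D v & hnorm (w - v) < eps.
Proof.
move=> dD e0.
have e0' : 0 < eps%:C by rewrite ltcR.
have [|v [/= vb Dv]] := dD (ball w eps%:C) _ (ball_open w eps%:C).
  by exists w; apply: ballxx.
exists v => //; rewrite -ltcR hnormE.
by move: vb; rewrite -ball_normE.
Qed.

Lemma hnorm_lim_le (u : nat -> H) l z (M : R) : u @ \oo --> l ->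
  (\forall n \near \oo, hnorm (u n - z) <= M) -> hnorm (l - z) <= M.
Proof.
move=> /cvg_hnormP ul uM; apply/ler_addgt0Pr => eps e0.
have [n [ln un]] := filter_ex (filterI (ul _ e0) uM).
have -> : l - z = (u n - z) + (l - u n) by rewrite [RHS]addrC subrKA.
by apply: le_trans (hnormD _ _) _; rewrite lerD// ltW.
Qed.

End HilbertBasics.

Lemma hcauchy_cvg (R : realType) (H : completeNormedModType R[i]) (u : nat -> H) :
  (forall eps : R, 0 < eps -> exists n, forall m, (n <= m)%N -> hnorm (u m - u n) < eps) ->
  cvgn u.
Proof.
move=> uC; apply: cauchy_cvg; apply: cauchy_exP => eps e0.
have er : (complex.Re eps)%:C = eps by rewrite RRe_real// gtr0_real.
have [|n un] := uC (complex.Re eps); first by rewrite -ltcR er.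
exists (u n); exists n => // m /= nm.
by rewrite -ball_normE /ball_ /= -normrN opprB -hnormE -er ltcR un.
Qed.

Section InnerProductBasics.
Variables (R : realType) (H : normedModType R[i]) (dot : {dot H for Num.conj}).
Hypothesis Hdot : induces_norm dot.
Implicit Types (u v w z : H) (a : R[i]).

Lemma dotC u v : dot u v = (dot v u)^*.
Proof. by rewrite (hermC dot u v) /= expr0 mul1r. Qed.

Lemma dotDl u v w : dot (u + v) w = dot u w + dot v w.
Proof. exact: linearDl. Qed.
Lemma dotBl u v w : dot (u - v) w = dot u w - dot v w.
Proof. exact: linearBl. Qed.
Lemma dotZl a v w : dot (a *: v) w = a * dot v w.
Proof. exact: linearZl_LR. Qed.
Lemma dot0l w : dot 0 w = 0.
Proof. exact: linear0l. Qed.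
Lemma dotDr u v w : dot w (u + v) = dot w u + dot w v.
Proof. exact: linearDr. Qed.
Lemma dotBr u v w : dot w (u - v) = dot w u - dot w v.
Proof. exact: linearBr. Qed.
Lemma dotZr a v w : dot w (a *: v) = a^* * dot w v.
Proof. by rewrite dotC dotZl rmorphM /= -dotC. Qed.
Lemma dot0r w : dot w 0 = 0.
Proof. exact: linear0r. Qed.
Lemma dot_suml I (r : seq I) (P : pred I) (f : I -> H) w :
  dot (\sum_(i <- r | P i) f i) w = \sum_(i <- r | P i) dot (f i) w.
Proof. exact: linear_sumlz. Qed.
Lemma dot_sumr I (r : seq I) (P : pred I) (f : I -> H) w :
  dot w (\sum_(i <- r | P i) f i) = \sum_(i <- r | P i) dot w (f i).
Proof. exact: linear_sumr. Qed.

Lemma dotzz z : dot z z = (hnorm z ^+ 2)%:C.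
Proof. by rewrite -Hdot rmorphXn /= hnormE. Qed.

Lemma hnorm_sqr z : hnorm z ^+ 2 = complex.Re (dot z z).
Proof. by rewrite dotzz. Qed.

Lemma cauchy_schwarz u v : `|dot u v| <= (hnorm u * hnorm v)%:C.
Proof.
have [->|v0] := eqVneq v 0; first by rewrite dot0r normr0 hnorm0 mulr0.
have hv : 0 < hnorm v by rewrite lt_neqAle hnorm_ge0 eq_sym hnorm_eq0 v0.
have vv0 : dot v v != 0 by rewrite dotzz eq_complex /= sqrf_eq0 gt_eqF.
set a := dot u v / dot v v.
have ort : dot (u - a *: v) v = 0.
  by rewrite dotBl dotZl /a divfK// subrr.
have pE : dot u v = a * dot v v by rewrite /a divfK.
have qJ : (dot v v)^* = dot v v by rewrite -dotC.
have E : dot u u = dot (u - a *: v) (u - a *: v) + `|a| ^+ 2 * dot v v.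
  rewrite dotBr dotZr ort mulr0 subr0 dotBl dotZl.
  by rewrite [dot v u]dotC pE rmorphM /= qJ normCK mulrA subrK.
rewrite -(@ler_pXn2r _ 2)// ?nnegrE ?normr_ge0// ?ler0c ?mulr_ge0 ?hnorm_ge0//.
rewrite pE normrM exprMn [`|dot v v|]ger0_norm; last by rewrite dotzz ler0c sqr_ge0.
have sqE w : (hnorm w)%:C ^+ 2 = dot w w by rewrite dotzz rmorphXn.
rewrite rmorphM /= exprMn !sqE [dot v v ^+ 2]expr2 mulrA ler_pM2r.
  by rewrite E lerDr dotzz ler0c sqr_ge0.
by rewrite dotzz ltcR exprn_gt0.
Qed.

Lemma re_dot_le u v : complex.Re (dot u v) <= hnorm u * hnorm v.
Proof.
rewrite -lecR; apply: le_trans (cauchy_schwarz u v).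
by apply: le_trans (normc_ge_Re _); rewrite lecR ler_norm.
Qed.

(** Testing against w itself would give the claim at once; density supplies
    test vectors arbitrarily close to w. *)
Lemma hnorm_le_dense (D : set H) w (K : R) : dense D -> 0 <= K ->
  (forall u, D u -> `|dot w u| <= (K * hnorm u)%:C) -> hnorm w <= K.
Proof.
move=> dD K0 wK.
have [->|w0] := eqVneq w 0; first by rewrite hnorm0.
have hw : 0 < hnorm w by rewrite lt_neqAle hnorm_ge0 eq_sym hnorm_eq0 w0.
rewrite -(ler_pM2r hw) -expr2; apply/ler_addgt0Pr => eps e0.
have d0 : 0 < eps / (K + hnorm w) by apply: divr_gt0 => //; lra.
have [u Du wu] := dense_approx w dD d0.
have h1 : hnorm w ^+ 2 <= K * hnorm u + hnorm w * hnorm (w - u).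
  rewrite hnorm_sqr -[in X in dot _ X](subrK u w) addrC dotDr raddfD /=.
  apply: lerD; last exact: re_dot_le.
  rewrite -lecR; apply: le_trans (wK _ Du).
  by apply: le_trans (normc_ge_Re _); rewrite lecR ler_norm.
have h2 : hnorm u <= hnorm w + hnorm (w - u).
  by rewrite -{1}[u](subKr w) hnormB.
have h3 : K * hnorm u <= K * (hnorm w + hnorm (w - u)) by apply: ler_wpM2l.
have h4 : hnorm (w - u) * (K + hnorm w) < eps by rewrite -ltr_pdivlMr//; lra.
lra.
Qed.

Lemma dot_limE (u : nat -> H) l v (c : R[i]) : u @ \oo --> l ->
  (\forall n \near \oo, dot (u n) v = c) -> dot l v = c.
Proof.
move=> /cvg_hnormP ul uc; apply/eqP; rewrite -subr_eq0 -normr_le0.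
have H1 (eps : R) : 0 < eps -> `|dot l v - c| <= eps%:C.
  move=> e0; have d0 : 0 < eps / (hnorm v + 1).
    by apply: divr_gt0 => //; have := hnorm_ge0 v; lra.
  have [n [un un2]] := filter_ex (filterI (ul _ d0) uc).
  rewrite -un2 -dotBl (le_trans (cauchy_schwarz _ _))// lecR.
  have hv := hnorm_ge0 v.
  apply: (@le_trans _ _ (hnorm (l - u n) * (hnorm v + 1))).
    by apply: ler_wpM2l; [exact: hnorm_ge0|lra].
  by rewrite -ler_pdivlMr ?ltW//; lra.
rewrite -cmodE lecR; apply/ler_addgt0Pr => eps e0; rewrite add0r.
by rewrite -lecR cmodE H1.
Qed.
End InnerProductBasics.

(** * The Heinz inequality for square roots *)

Lemma bernoulli (R : realDomainType) (t : R) n : 1 <= t -> 1 + n%:R * (t - 1) <= t ^+ n.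
Proof.
move=> t1; elim: n => [|n IH]; first by rewrite mul0r addr0 expr0.
rewrite exprS -natr1; have := ler_wpM2l (le_trans ler01 t1) IH.
have : 0 <= n%:R * (t - 1) * (t - 1) by rewrite !mulr_ge0 ?subr_ge0.
lra.
Qed.

(** How the constants disappear from Krein's iteration: only the growth rate of
    the powers matters. *)
Lemma le1_of_exp2_bounded (R : realType) (t M : R) :
  (forall j, t ^+ (2 ^ j) <= M) -> t <= 1.
Proof.
move=> tM; rewrite leNgt; apply/negP => t1.
have d0 : 0 < t - 1 by lra.
set j := Num.truncn (M / (t - 1)).
have jM : M < j.+1%:R * (t - 1) by rewrite -ltr_pdivrMr// truncnS_gt.
have h1 := bernoulli (2 ^ j.+1) (ltW t1).
have h2 : j.+1%:R * (t - 1) <= (2 ^ j.+1)%N%:R * (t - 1).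
  by apply: ler_wpM2r; [exact: ltW|rewrite ler_nat ltnW// ltn_expl].
have := tM j.+1; lra.
Qed.

Section Operators.
Variables (R : realType) (H : completeNormedModType R[i]) (dot : {dot H for Num.conj}).
Hypothesis Hdot : induces_norm dot.
Implicit Types (u v w z : H) (A B S T : operator H).

Lemma self_adjoint_sym T u v : self_adjoint dot T -> opdom T u -> opdom T v ->
  dot (T u) v = dot u (T v).
Proof. by case=> _ _ Tsa Du Dv; have [_] := Tsa v (T v); apply. Qed.

(** If 0 were in the spectrum it would be an eigenvalue, which positivity
    excludes; so 0 is in the resolvent set. *)
Lemma surjective_of_discrete_pd T : positive_definite dot T -> discrete_spectrum T ->
  forall w, exists2 z, opdom T z & T z = w.
Proof.
move=> [g g0 Tg] Td w.
have [T0|nT0] := pselect (spectrum T 0).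
  have [_ [v [Dv Tv] v0] _] := Td _ T0.
  have := Tg _ Dv; rewrite Tv scale0r dot0l -hnormE -rmorphXn /= -rmorphM /= lecR.
  have : 0 < hnorm v by rewrite lt_neqAle hnorm_ge0 eq_sym hnorm_eq0 v0.
  by move=> hv; rewrite leNgt mulr_gt0// exprn_gt0.
have [/(_ w)[z [[Dz <-] _]] _] : resolvent_set T 0 by apply: contrapT.
by exists z => //; rewrite scale0r subr0.
Qed.

(** Hellinger-Toeplitz, by a gliding hump.  The vectors g are the values of the
    adjoint of T on D.  If T is unbounded there are vg n = (v, g) with
    |g| > 8^n |v|.  The points x n move by at most q n = 4^-n each time, chosen
    so that the pairing with g is at least |g| 4^-n / 2; the later moves add up
    to at most 4^-n / 3 and cannot undo this.  So the limit l satisfies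
    |(l, g)| >= |g| 4^-n / 6, while (l, g) = (T l, v), and therefore
    2^n <= 6 |T l| for all n. *)
Lemma bounded_of_adjoint (T : H -> H) (D : set H) : dense D ->
  (forall v, D v -> exists g, forall u, dot (T u) v = dot u g) ->
  exists2 C : R, 0 <= C & forall u, hnorm (T u) <= C * hnorm u.
Proof.
move=> dD adjT; apply: contrapT => nC.
have hump n : exists vg : H * H, [/\ forall u, dot (T u) vg.1 = dot u vg.2,
    0 < hnorm vg.1 & 8 ^+ n * hnorm vg.1 < hnorm vg.2].
  apply: contrapT => nvg; apply: nC; exists (8 ^+ n) => [|u]; first exact: exprn_ge0.
  apply: (hnorm_le_dense Hdot dD) => [|v Dv].
    by rewrite mulr_ge0 ?exprn_ge0// hnorm_ge0.
  have [g vg] := adjT _ Dv; rewrite vg.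
  apply: le_trans (cauchy_schwarz Hdot _ _) _; rewrite lecR mulrAC mulrC.
  rewrite ler_wpM2r ?hnorm_ge0//.
  have [hv|hv] := ltP 0 (hnorm v).
    by rewrite leNgt; apply/negP => gv; apply: nvg; exists (v, g).
  have v0 : v = 0 by apply/eqP; rewrite -hnorm_eq0 eq_le hv hnorm_ge0.
  have g0 : hnorm g ^+ 2 == 0 by rewrite (hnorm_sqr Hdot) -vg v0 dot0r.
  by rewrite v0 hnorm0 mulr0 -(eqP _ : hnorm g = 0) //; rewrite sqrf_eq0 in g0.
have [vg vgP] := choice hump.
pose q n : R := 4^-1 ^+ n.
pose step n x := let g := (vg n).2 in
  if (hnorm g * q n / 2)%:C <= `|dot x g| then x
  else x + (q n / hnorm g)%:C *: g.
pose fix x n : H := if n is m.+1 then step m (x m) else 0.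
have q0 n : 0 < q n by rewrite exprn_gt0.
have qS n : q n.+1 = q n / 4 by rewrite /q exprSr.
have g0 n : 0 < hnorm (vg n).2.
  have [_ v0] := vgP n; apply: le_lt_trans.
  by rewrite mulr_ge0 ?exprn_ge0// ltW.
have stepn n y : hnorm (step n y - y) <= q n.
  rewrite /step; case: ifP => _; first by rewrite subrr hnorm0 ltW.
  rewrite addrAC subrr add0r hnormZr ger0_norm ?divfK ?gt_eqF//.
  by rewrite divr_ge0// ltW.
have stepg n y : (hnorm (vg n).2 * q n / 2)%:C <= `|dot (step n y) (vg n).2|.
  rewrite /step; case: ifP => // /negbT.
  rewrite -cmodE lecR -ltNge => yg.
  rewrite dotDl dotZl (dotzz Hdot) -rmorphM /=.
  have -> : q n / hnorm (vg n).2 * hnorm (vg n).2 ^+ 2 = hnorm (vg n).2 * q n.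
    by rewrite expr2 mulrA divfK ?gt_eqF// mulrC.
  rewrite addrC; apply: le_trans (lerB_normD _ _).
  have hq : 0 <= hnorm (vg n).2 * q n by rewrite mulr_ge0// ltW.
  rewrite ger0_norm ?ler0c// -cmodE -rmorphB lecR; lra.
have xx n j : hnorm (x (n + j)%N - x n) <= 4 / 3 * (q n - q (n + j)%N).
  elim: j => [|j IH]; first by rewrite addn0 !subrr hnorm0 mulr0.
  rewrite addnS; have := stepn (n + j)%N (x (n + j)%N); rewrite -/(x (n + j).+1).
  rewrite -[x _.+1 - x n](subrKA (x (n + j)%N)) => h.
  apply: le_trans (hnormD _ _) _; rewrite qS; lra.
have ux : cvgn x.
  apply: hcauchy_cvg => eps e0; apply: contrapT => nq.
  have : (4 : R) <= 1; last by lra.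
  apply: (@le1_of_exp2_bounded _ _ (4 / 3 / eps)) => j.
  rewrite leNgt; apply/negP => jM; apply: nq; exists (2 ^ j)%N => m jm.
  rewrite -(subnKC jm); apply: le_lt_trans (xx _ _) _.
  have : 4 / 3 * q (2 ^ j)%N < eps.
    by rewrite /q exprVn ltr_pdivrMr ?exprn_gt0// [eps * _]mulrC -ltr_pdivrMr.
  by have := q0 (2 ^ j + (m - 2 ^ j))%N; lra.
have : (2 : R) <= 1; last by lra.
apply: (@le1_of_exp2_bounded _ _ (6 * hnorm (T (limn x)))) => j.
move: (2 ^ j)%N => n {j}; set l := limn x; set v := (vg n).1; set g := (vg n).2.
have [vgE v0 vg8] := vgP n.
have lx : hnorm (l - x n.+1) <= q n / 3.
  apply: hnorm_lim_le ux _; exists n.+1 => // m /= nm.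
  rewrite -(subnKC nm); apply: le_trans (xx _ _) _; rewrite qS.
  by have := q0 (n.+1 + (m - n.+1))%N; lra.
have h1 := stepg n (x n); rewrite -/(x n.+1) -/g in h1.
have h2 : `|dot (x n.+1) g| <= `|dot l g| + (hnorm (l - x n.+1) * hnorm g)%:C.
  have -> : x n.+1 = l - (l - x n.+1) by rewrite subKr.
  rewrite dotBl; apply: le_trans (ler_normB _ _) _; rewrite lerD2l subKr.
  exact: cauchy_schwarz.
have h3 : `|dot l g| <= (hnorm (T l) * hnorm v)%:C.
  by rewrite -vgE; exact: cauchy_schwarz.
have h4 := le_trans h1 (le_trans h2 (lerD h3 (lexx _))).
rewrite -rmorphD /= lecR in h4.
have h5 : hnorm (l - x n.+1) * hnorm g <= q n / 3 * hnorm g.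
  by apply: ler_wpM2r lx; exact: hnorm_ge0.
have h6 : q n * (8 ^+ n * hnorm v) <= q n * hnorm g.
  by apply: ler_wpM2l; exact: ltW.
have q8 : q n * 8 ^+ n = 2 ^+ n.
  by rewrite /q -exprMn; congr (_ ^+ _); field.
rewrite mulrA q8 in h6.
by rewrite -(ler_pM2r v0); lra.
Qed.

(** The everywhere defined operator A B^-1 has the densely defined formal
    adjoint B^-1 A, so it is bounded. *)
Lemma relatively_bounded A B : self_adjoint dot A -> self_adjoint dot B ->
  opdom A = opdom B -> (forall w, exists2 z, opdom B z & B z = w) ->
  exists2 C : R, 0 <= C & forall z, opdom B z -> hnorm (A z) <= C * hnorm (B z).
Proof.
move=> Asa Bsa AB Bsurj.
have /choice[G GP] w : exists z, opdom B z /\ B z = w.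
  by have [z Dz Bz] := Bsurj w; exists z.
have GB z : opdom B z -> G (B z) = z.
  move=> Dz; have [Dz' zz'] := GP (B z).
  apply/eqP; rewrite -subr_eq0 -hnorm_eq0 -sqrf_eq0.
  have [u Du uE] := Bsurj (G (B z) - z).
  rewrite (hnorm_sqr Hdot) -[X in dot _ X]uE dotBl -!self_adjoint_sym//.
  by rewrite zz' subrr.
have [||C C0 AC] := @bounded_of_adjoint (fun w => A (G w)) (opdom A).
- by case: Asa.
- move=> v Dv; exists (G (A v)) => u.
  have [Du Bu] := GP u; have [DAv BAv] := GP (A v).
  rewrite (self_adjoint_sym Asa)// ?AB// -{1}BAv -(self_adjoint_sym Bsa)//.
  by rewrite Bu.
by exists C => // z Dz; rewrite -[in A z](GB z Dz).
Qed.

(** Krein's argument.  Put u m = (B^-1 A)^m z and q m = Re (B (u m), z).  As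
    B^-1 A is symmetric for the form (B u, v), q (m + l) is also the form at
    u m and u l, and Cauchy-Schwarz for the form gives
    (q m)^2 <= q 0 * q (2m).  Hence (q 1 / q 0)^(2^j) <= q (2^j) / q 0, and the
    right-hand side is at most C^(2^j) up to a factor independent of j. *)
Lemma form_bounded A B (C : R) z : self_adjoint dot A -> self_adjoint dot B ->
  positive_definite dot B -> opdom A = opdom B ->
  (forall w, exists2 z, opdom B z & B z = w) -> 0 < C ->
  (forall z, opdom B z -> hnorm (A z) <= C * hnorm (B z)) ->
  opdom B z -> complex.Re (dot (A z) z) <= C * complex.Re (dot (B z) z).
Proof.
move=> Asa Bsa [g g0 Bg] AB Bsurj C0 ABC Dz.
have /choice[K KP] u : exists k, opdom B k /\ B k = A u.
  by have [k Dk Bk] := Bsurj (A u); exists k.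
pose u m := iter m K z.
have Du m : opdom B (u m) by case: m => // m; case: (KP (u m)).
have Bu m : B (u m.+1) = A (u m) by case: (KP (u m)).
pose q m := complex.Re (dot (B (u m)) z).
have shift m l : dot (B (u (m + l)%N)) z = dot (B (u m)) (u l).
  elim: l m => [|l IH] m; first by rewrite addn0.
  rewrite addnS -addSn IH Bu self_adjoint_sym ?AB// -Bu.
  by rewrite -self_adjoint_sym.
have Bpos v : opdom B v -> 0 <= complex.Re (dot (B v) v).
  move=> Dv; have := Bg v Dv; rewrite -hnormE -rmorphXn -rmorphM lecE => /andP[_].
  by apply: le_trans; rewrite /= mulr_ge0 ?sqr_ge0// ltW.
have [z0|z0] := eqVneq z 0.
  by rewrite z0 !dot0r /= mulr0.
have q0 : 0 < q 0.
  have := Bg z Dz; rewrite -hnormE -rmorphXn -rmorphM lecE => /andP[_].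
  apply: lt_le_trans; rewrite /= mulr_gt0// exprn_gt0//.
  by rewrite lt_neqAle hnorm_ge0 eq_sym hnorm_eq0 z0.
have qq m : q m ^+ 2 <= q 0 * q (m + m)%N.
  have DL : linear_op B by case: Bsa.
  (* The point of the line u m + R z at which the form is least. *)
  have [Dv Bv] := DL.2 (- (q m / q 0))%:C z (u m) Dz (Du m).
  have := Bpos _ Dv; rewrite Bv dotDl !dotDr !dotZl !dotZr.
  rewrite conjCr !ReD !ReZ -(shift 0 m) -(shift m m) add0n.
  rewrite -/(q m) -/(q (m + m)%N) -/(q 0).
  move: (q 0) (q m) (q (m + m)%N) q0 => a b c a0.
  have -> : - (b / a) * (- (b / a) * a) + - (b / a) * b + (- (b / a) * b + c)
    = (a * c - b ^+ 2) / a by field; exact: lt0r_neq0.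
  by rewrite pmulr_lge0 ?invr_gt0// subr_ge0.
have qC m : q m <= C ^+ m * (hnorm (B z) * hnorm z).
  apply: le_trans (re_dot_le Hdot _ _) _; rewrite mulrA ler_wpM2r ?hnorm_ge0//.
  elim: m => [|m IH]; first by rewrite expr0 mul1r.
  rewrite Bu exprS -mulrA; apply: le_trans (ABC _ (Du m)) _.
  by rewrite ler_pM2l.
have -> : complex.Re (dot (A z) z) = q 1 by rewrite /q Bu.
rewrite -/(q 0).
have [q1|q1] := leP (q 1) 0; first by apply: le_trans q1 _; rewrite mulr_ge0 ?ltW.
rewrite -ler_pdivrMl// -[X in _ <= X]mul1r -ler_pdivrMr//.
set t := _ / _.
have t0 : 0 <= t by rewrite /t !mulr_ge0 ?invr_ge0 ?ltW.
apply: (@le1_of_exp2_bounded _ _ (hnorm (B z) * hnorm z / q 0)) => j.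
have tj : t ^+ (2 ^ j) <= q (2 ^ j)%N / C ^+ (2 ^ j) / q 0.
  elim: j => [|j IH]; first by rewrite expn0 !expr1 /t [C^-1 * _]mulrC.
  rewrite expnS mul2n -addnn !exprD.
  set N := (2 ^ j)%N in IH *.
  apply: le_trans (ler_pM _ _ IH IH) _; rewrite ?exprn_ge0//.
  have := qq N; have := exprn_gt0 N C0.
  move: (q 0) (q N) (q (N + N)%N) (C ^+ N) q0 => a b c d a0 d0 bc.
  have -> : b / d / a * (b / d / a) = b ^+ 2 / (d * d * a * a).
    by field; rewrite !lt0r_neq0.
  have -> : c / (d * d) / a = a * c / (d * d * a * a).
    by field; rewrite !lt0r_neq0.
  by rewrite ler_pM2r// invr_gt0 !mulr_gt0.
apply: le_trans tj _; rewrite ler_pM2r ?invr_gt0//.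
by rewrite ler_pdivrMr ?exprn_gt0// mulrC.
Qed.

Lemma linear_op0 T : linear_op T -> T 0 = 0.
Proof.
move=> [T0 TL]; have [_] := TL 1 0 0 T0 T0.
by rewrite !scale1r addr0 => /eqP; rewrite -subr_eq0 opprD addNKr oppr_eq0 => /eqP.
Qed.

Lemma linear_opZ T a u : linear_op T -> opdom T u ->
  opdom T (a *: u) /\ T (a *: u) = a *: T u.
Proof.
move=> LT Du; have [T0 TL] := LT; have [] := TL a u 0 Du T0.
by rewrite !addr0 linear_op0// addr0.
Qed.

Lemma linear_opB T u v : linear_op T -> opdom T u -> opdom T v ->
  opdom T (u - v) /\ T (u - v) = T u - T v.
Proof.
move=> [T0 TL] Du Dv; have [] := TL (-1) v u Dv Du.
by rewrite !scaleN1r ![- _ + _]addrC.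
Qed.

Lemma sqrt_op_dom A S z : is_sqrt_op dot A S -> opdom A z ->
  [/\ opdom S z, opdom S (S z) & S (S z) = A z].
Proof.
by move=> [_ _ [SA SE]] Dz; have := SE z Dz; move: Dz; rewrite -SA => -[].
Qed.

Lemma sqrt_op_form A S z : is_sqrt_op dot A S -> opdom A z ->
  hnorm (S z) ^+ 2 = complex.Re (dot (A z) z).
Proof.
move=> AS Dz; have [DSz DSSz <-] := sqrt_op_dom AS Dz.
have [Ssa _ _] := AS; rewrite (hnorm_sqr Hdot).
by rewrite (self_adjoint_sym Ssa).
Qed.

(** On the domain of B = T T the claim is the form bound.  In general, pair
    S z with u and write S u = T u', so that (S z, u) = (T z, u').  Now
    approximate T z by some w = T v in the domain of T: then v lies in the
    domain of T T, where the bound is known, and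
    (w, u') = (v, S u) = (S v, u). *)
Lemma heinz A B S T : self_adjoint dot A -> self_adjoint dot B ->
  positive_definite dot B -> opdom A = opdom B ->
  (forall w, exists2 z, opdom B z & B z = w) ->
  is_sqrt_op dot A S -> is_sqrt_op dot B T ->
  exists C : R, forall z, opdom S z -> opdom T z -> hnorm (S z) <= C * hnorm (T z).
Proof.
move=> Asa Bsa Bpd AB Bsurj AS BT.
have [C0 C00 hC0] := relatively_bounded Asa Bsa AB Bsurj.
have [Ssa _ _] := AS; have [Tsa _ [TB _]] := BT.
pose K := Num.sqrt (C0 + 1); have K0 : 0 <= K by rewrite sqrtr_ge0.
have core z : opdom B z -> hnorm (S z) <= K * hnorm (T z).
  move=> Dz; rewrite -(@ler_pXn2r _ 2)// ?nnegrE ?mulr_ge0 ?hnorm_ge0//.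
  rewrite exprMn sqr_sqrtr; last by rewrite addr_ge0.
  rewrite (sqrt_op_form AS) ?AB// (sqrt_op_form BT)//.
  apply: (form_bounded Asa Bsa Bpd AB Bsurj) => //; first by rewrite ltr_wpDl.
  move=> v Dv; apply: le_trans (hC0 v Dv) _.
  by apply: ler_wpM2r; [exact: hnorm_ge0|rewrite lerDl].
have Tsurj w : exists2 v, opdom T v & T v = w.
  have [z Dz <-] := Bsurj w; have [_ ? ?] := sqrt_op_dom BT Dz.
  by exists (T z).
exists K => z DSz DTz.
apply: (hnorm_le_dense Hdot (D := opdom S)); first by case: Ssa.
  by rewrite mulr_ge0// hnorm_ge0.
move=> u Du; have [u' Du' uu'] := Tsurj (S u).
rewrite (self_adjoint_sym Ssa)// -uu' -(self_adjoint_sym Tsa)//.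
rewrite -cmodE lecR; apply/ler_addgt0Pr => eps e0.
have hu := hnorm_ge0 u; have hu' := hnorm_ge0 u'.
have d0 : 0 < K * hnorm u + hnorm u' + 1.
  by apply: ltr_wpDl => //; rewrite addr_ge0// mulr_ge0.
have [|w Dw zw] := dense_approx (T z) (D := opdom T) _ (divr_gt0 e0 d0).
  by case: Tsa.
have [v Dv vw] := Tsurj w.
have DBv : opdom B v by rewrite -TB; split=> //=; rewrite vw.
have [DSv _ _] : [/\ opdom S v, opdom S (S v) & S (S v) = A v].
  by apply: (sqrt_op_dom AS); rewrite AB.
have wu : `|dot w u'| <= (K * hnorm w * hnorm u)%:C.
  rewrite -vw (self_adjoint_sym Tsa)// uu' -(self_adjoint_sym Ssa)//.
  apply: le_trans (cauchy_schwarz Hdot _ _) _; rewrite lecR.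
  by apply: ler_wpM2r => //; exact: core.
have zu : `|dot (T z) u'| <= (hnorm (T z - w) * hnorm u' + K * hnorm w * hnorm u)%:C.
  rewrite -[T z in X in X <= _](subrK w) dotDl rmorphD.
  by apply: le_trans (ler_normD _ _) (lerD (cauchy_schwarz Hdot _ _) wu).
rewrite -cmodE lecR in zu; apply: le_trans zu _.
have hw : hnorm w <= hnorm (T z) + hnorm (T z - w).
  by rewrite -{1}[w](subKr (T z)) hnormB.
have h1 : K * hnorm w * hnorm u <= K * (hnorm (T z) + hnorm (T z - w)) * hnorm u.
  by apply: ler_wpM2r => //; apply: ler_wpM2l.
have h2 : hnorm (T z - w) * (K * hnorm u + hnorm u' + 1) < eps.
  by rewrite -ltr_pdivlMr.
by have := hnorm_ge0 (T z - w); lra.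
Qed.

(** The existence of some bound C is what makes opnorm, a supremum, the best
    bound. *)
Lemma opnorm_comp_inv S T (C : R) : linear_op S -> linear_op T ->
  (forall z, opdom S z -> S z = 0 -> z = 0) ->
  (forall z, opdom S z -> opdom T z -> hnorm (T z) <= C * hnorm (S z)) ->
  forall z, opdom S z -> opdom T z ->
    hnorm (T z) <= opnorm (comp_op T (inv_op S)) * hnorm (S z).
Proof.
move=> SL TL Sinj STC z DSz DTz.
have invS v : opdom S v -> inv_op S (S v) = v.
  move=> Dv /=; case: xgetP => [v' _ [Dv' vv']|/(_ v) []//].
  apply/eqP; rewrite -subr_eq0; apply/eqP.
  have [DB BE] := linear_opB SL Dv' Dv.
  by apply: Sinj => //; rewrite BE vv' subrr.
have [Sz0|Sz0] := eqVneq (S z) 0.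
  by rewrite (Sinj _ DSz Sz0) (linear_op0 TL) (linear_op0 SL) !hnorm0 mulr0.
have h0 : 0 < hnorm (S z) by rewrite lt_neqAle hnorm_ge0 eq_sym hnorm_eq0 Sz0.
rewrite -ler_pdivrMr//; apply: ub_le_sup.
  exists `|C| => _ [w [[[v Dv <-] /= DTv] hw] <-].
  move: DTv; rewrite -[xget _ _]/(inv_op S (S v)) (invS v Dv) => DTv.
  apply: le_trans (STC v Dv DTv) _.
  apply: le_trans (_ : `|C| * hnorm (S v) <= _).
    by apply: ler_wpM2r; [exact: hnorm_ge0|exact: ler_norm].
  by rewrite ler_piMr.
have [Da aE] := linear_opZ (hnorm (S z))^-1%:C SL DSz.
have [Db bE] := linear_opZ (hnorm (S z))^-1%:C TL DTz.
set y := _ *: z in Da Db aE bE.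
exists (S y).
  split; first split; first by exists y.
    by change (opdom T (inv_op S (S y))); rewrite invS.
  by rewrite aE hnormZr ger0_norm ?invr_ge0 ?hnorm_ge0// mulVf ?gt_eqF.
change (hnorm (T (inv_op S (S y))) = hnorm (T z) / hnorm (S z)).
rewrite invS// bE hnormZr.
by rewrite ger0_norm ?invr_ge0 ?hnorm_ge0// mulrC.
Qed.
End Operators.

(** * Expansions in an orthonormal basis *)

Section OrthonormalBasis.
Variables (R : realType) (H : completeNormedModType R[i]) (dot : {dot H for Num.conj}).
Hypothesis Hdot : induces_norm dot.
Variable e : nat -> H.
Hypothesis eB : orthonormal_basis dot e.
Implicit Types (u v w z : H) (a : nat -> R[i]).

Lemma dot_sum_basis a m n j :
  dot (\sum_(m <= k < n) a k *: e k) (e j) = if (m <= j < n)%N then a j else 0.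
Proof.
rewrite dot_suml.
under eq_bigr => k _ do rewrite dotZl eB.1.
have [mjn|mjn] := ifP.
  rewrite (bigD1_seq j) ?mem_index_iota ?iota_uniq//= eqxx mulr1 big1 ?addr0// => k /negbTE kj.
  by rewrite kj mulr0.
rewrite big_nat_cond big1// => k /andP[mkn _]; case: eqP => [kj|_]; last exact: mulr0.
by rewrite -kj mkn in mjn.
Qed.

Lemma hnorm_sum_basis a m n :
  hnorm (\sum_(m <= k < n) a k *: e k) ^+ 2 = \sum_(m <= k < n) cmod (a k) ^+ 2.
Proof.
apply: complexI; rewrite -(dotzz Hdot) dot_sumr rmorph_sum /=.
apply: eq_big_nat => k mkn; rewrite dotZr dot_sum_basis mkn.
by rewrite rmorphXn /= cmodE normCK mulrC.
Qed.

Lemma basis_partial_sum_cvg z :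
  (fun n => \sum_(0 <= k < n) dot z (e k) *: e k) @ \oo --> z.
Proof. exact: (eB.2 z). Qed.

Lemma coef_limit a w j : (fun n => \sum_(0 <= k < n) a k *: e k) @ \oo --> w ->
  dot w (e j) = a j.
Proof.
move=> aw; apply: (dot_limE Hdot aw); exists j.+1 => // n /= jn.
by rewrite dot_sum_basis jn.
Qed.

Lemma bessel z n : \sum_(0 <= k < n) cmod (dot z (e k)) ^+ 2 <= hnorm z ^+ 2.
Proof.
set p := \sum_(0 <= k < n) dot z (e k) *: e k.
have pz : dot (z - p) p = 0.
  rewrite {2}/p dot_sumr big1_seq // => k /andP[_]; rewrite mem_index_iota => kn.
  by rewrite dotZr dotBl dot_sum_basis kn subrr mulr0.
rewrite -hnorm_sum_basis -/p !(hnorm_sqr Hdot).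
have -> : dot z z = dot (z - p) (z - p) + dot p p.
  have zp : dot p (z - p) = 0 by rewrite dotC pz rmorph0.
  rewrite -{1 2}(subrK p z); move: (z - p) pz zp => y py yp.
  by rewrite dotDl !dotDr py yp addr0 add0r.
by rewrite ReD lerDr -(hnorm_sqr Hdot) sqr_ge0.
Qed.

Lemma hnorm_le_of_coef z (M : R) : 0 <= M ->
  (forall n, \sum_(0 <= k < n) cmod (dot z (e k)) ^+ 2 <= M ^+ 2) -> hnorm z <= M.
Proof.
move=> M0 zM; rewrite -[z]subr0; apply: (hnorm_lim_le (@basis_partial_sum_cvg z)).
apply: nearW => n; rewrite subr0 -(@ler_pXn2r _ 2)// ?nnegrE ?hnorm_ge0//.
by rewrite hnorm_sum_basis.
Qed.

Lemma eq_of_coef u v : (forall k, dot u (e k) = dot v (e k)) -> u = v.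
Proof.
move=> uv; apply/eqP; rewrite -subr_eq0 -hnorm_eq0 eq_le hnorm_ge0 andbT.
apply: hnorm_le_of_coef => // n; rewrite big1 ?sqr_ge0// => k _.
by rewrite dotBl uv subrr (cmodr 0) normr0 expr0n.
Qed.

Lemma riesz_fischer a (M : R) : (forall n, \sum_(0 <= k < n) cmod (a k) ^+ 2 <= M) ->
  exists w, forall k, dot w (e k) = a k.
Proof.
move=> aM; set s := fun n => \sum_(0 <= k < n) a k *: e k.
pose b n := \sum_(0 <= k < n) cmod (a k) ^+ 2.
have b_incr : nondecreasing_seq b.
  apply/nondecreasing_seqP => n; rewrite /b big_nat_recr//= lerDl sqr_ge0//.
have b_ub : has_ubound (range b) by exists M => _ [n _ <-]; exact: aM.
have bC := nondecreasing_cvgn b_incr b_ub.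
have sC : cvgn s.
  apply: hcauchy_cvg => eps e0.
  have e20 : 0 < eps ^+ 2 by rewrite exprn_gt0.
  have /cvgrPdist_lt/(_ _ e20)[n _ nb] := bC; exists n => m nm.
  rewrite -(@ltr_pXn2r _ 2)// ?nnegrE ?hnorm_ge0 ?ltW//.
  have -> : s m - s n = \sum_(n <= k < m) a k *: e k.
    by rewrite /s (big_cat_nat (leq0n n) nm)//= addrAC subrr add0r.
  rewrite hnorm_sum_basis.
  have -> : \sum_(n <= k < m) cmod (a k) ^+ 2 = b m - b n.
    by rewrite /b (big_cat_nat (leq0n n) nm)//= addrAC subrr add0r.
  have bn := nb n (leqnn n); rewrite ger0_norm in bn.
    apply: le_lt_trans bn; rewrite lerD2r; apply: ub_le_sup => //.
  by rewrite subr_ge0; apply: ub_le_sup.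
by exists (limn s) => k; apply: coef_limit sC.
Qed.

(** Parseval, in the form that moves a diagonal operator from one side of the
    inner product to the other: equality of the coefficientwise products
    suffices. *)
Lemma dot_eq_of_coef u u' v v' :
  (forall k, dot u' (e k) * (dot v (e k))^* = dot u (e k) * (dot v' (e k))^*) ->
  dot u' v = dot u v'.
Proof.
move=> H0; apply/eqP; rewrite -subr_eq0 -normr_le0 -cmodE lecR.
apply/ler_addgt0Pr => eps e0; rewrite add0r.
have d0 : 0 < eps / (hnorm v + hnorm u + 1).
  by apply: divr_gt0 => //; have := hnorm_ge0 v; have := hnorm_ge0 u; lra.
have /cvg_hnormP/(_ _ d0) near1 := @basis_partial_sum_cvg u'.
have /cvg_hnormP/(_ _ d0) near2 := @basis_partial_sum_cvg v'.
have [n [n1 n2]] := filter_ex (filterI near1 near2).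
set p := \sum_(0 <= k < n) _ *: _ in n1; set q := \sum_(0 <= k < n) _ *: _ in n2.
have pq : dot p v = dot u q.
  rewrite dot_suml dot_sumr; apply: eq_bigr => k _.
  by rewrite dotZl dotZr [dot (e k) v]dotC H0 mulrC.
have -> : dot u' v - dot u v' = dot (u' - p) v - dot u (v' - q).
  by rewrite dotBl dotBr pq; ring.
rewrite -lecR cmodE; apply: le_trans (ler_normB _ _) _.
apply: le_trans (lerD (cauchy_schwarz Hdot _ _) (cauchy_schwarz Hdot _ _)) _.
rewrite -rmorphD lecR.
have h1 := ler_wpM2r (hnorm_ge0 v) (ltW n1).
have h2 := ler_wpM2l (hnorm_ge0 u) (ltW n2).
have h3 : eps / (hnorm v + hnorm u + 1) * (hnorm v + hnorm u + 1) = eps.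
  by rewrite divfK// gt_eqF//; have := hnorm_ge0 v; have := hnorm_ge0 u; lra.
by have := ltW d0; lra.
Qed.
End OrthonormalBasis.

(** * Diagonal operators *)

Section SpectralCalculus.
Variables (R : realType) (H : completeNormedModType R[i]) (dot : {dot H for Num.conj}).
Hypothesis Hdot : induces_norm dot.
Variable e : nat -> H.
Hypothesis eB : orthonormal_basis dot e.
Variable lam : nat -> R.
Implicit Types (u v w z : H) (f : R -> R[i]) (phi : R -> R) (alpha h : R).

(** Domains of diagonal operators are compared through this criterion.  Two
    dominating vectors are allowed because the bounds in use have the shape
    lam <= lam^2 + 1. *)
Lemma dominated_coef (c : nat -> R[i]) u v :
  (forall k, cmod (c k) ^+ 2 <= cmod (dot u (e k)) ^+ 2 + cmod (dot v (e k)) ^+ 2) ->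
  exists w, forall k, dot w (e k) = c k.
Proof.
move=> cuv; apply: (riesz_fischer Hdot eB (M := hnorm u ^+ 2 + hnorm v ^+ 2)) => n.
apply: le_trans (lerD (bessel Hdot eB u n) (bessel Hdot eB v n)).
by rewrite -big_split; apply: ler_sum => k _; exact: cuv.
Qed.

Lemma spectral_op_coef f z k : opdom (spectral_op dot e lam f) z ->
  dot (spectral_op dot e lam f z) (e k) = f (lam k) * dot z (e k).
Proof. by move=> Dz; apply: (coef_limit Hdot eB) Dz. Qed.

(** Membership in the domain, a convergence condition, becomes solvability of
    the coefficient equations; the basis property does the converging. *)
Lemma spectral_op_domP f z : opdom (spectral_op dot e lam f) z <->
  exists w, forall k, dot w (e k) = f (lam k) * dot z (e k).
Proof.
split=> [Dz|[w wE]]; first by exists (spectral_op dot e lam f z) => k; apply: spectral_op_coef.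
apply/cvg_ex; exists w; have := eB.2 w.
by under [X in series X]eq_fun => k do rewrite wE.
Qed.

Lemma spectral_op_eq f z w : (forall k, dot w (e k) = f (lam k) * dot z (e k)) ->
  opdom (spectral_op dot e lam f) z /\ spectral_op dot e lam f z = w.
Proof.
move=> wE; have Dz : opdom (spectral_op dot e lam f) z by apply/spectral_op_domP; exists w.
by split=> //; apply: (eq_of_coef Hdot eB) => k; rewrite spectral_op_coef.
Qed.

Lemma spectral_op_linear f : linear_op (spectral_op dot e lam f).
Proof.
split; first by apply/spectral_op_domP; exists 0 => k; rewrite dot0l mulr0.
move=> a u v Du Dv; apply: spectral_op_eq => k.
by rewrite !dotDl !dotZl !spectral_op_coef// mulrDr mulrCA.
Qed.

Lemma spectral_op_basis f j : opdom (spectral_op dot e lam f) (e j).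
Proof.
apply/spectral_op_domP; exists (f (lam j) *: e j) => k.
by rewrite dotZl eB.1; case: eqP => [->|_] //; rewrite !mulr0.
Qed.

(** The partial sums of the expansion of a vector lie in the domain. *)
Lemma spectral_op_dense f : dense (opdom (spectral_op dot e lam f)).
Proof.
move=> O [z Oz] openO.
have /= [n _ nO] := eB.2 z O (open_nbhs_nbhs (conj openO Oz)).
exists (\sum_(0 <= k < n) dot z (e k) *: e k); split; first exact: (nO n (leqnn n)).
have [D0 DL] := spectral_op_linear f.
elim: n {nO} => [|n IH]; first by rewrite big_geq.
rewrite big_nat_recr//= addrC.
by have [] := DL (dot z (e n)) _ _ (@spectral_op_basis f n) IH.
Qed.

(** Testing the adjoint on e k determines the k-th coefficient, so the adjoint
    is the same diagonal operator. *)
Lemma spectral_op_self_adjoint phi :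
  self_adjoint dot (spectral_op dot e lam (fun s => (phi s)%:C)).
Proof.
split; [exact: spectral_op_linear|exact: spectral_op_dense|move=> v w; split].
  move=> vw; apply: spectral_op_eq => k.
  have Dk := @spectral_op_basis (fun s => (phi s)%:C) k.
  rewrite dotC -(vw _ Dk).
  have [_ ->] : opdom (spectral_op dot e lam (fun s => (phi s)%:C)) (e k) /\
      spectral_op dot e lam (fun s => (phi s)%:C) (e k) = (phi (lam k))%:C *: e k.
    apply: spectral_op_eq => j.
    by rewrite dotZl eB.1; case: eqP => [->|_] //; rewrite !mulr0.
  by rewrite dotZl rmorphM /= conjCr -dotC.
move=> [Dv <-] u Du; apply: (dot_eq_of_coef Hdot eB) => k.
by rewrite !spectral_op_coef// rmorphM /= conjCr mulrCA mulrA.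
Qed.

(** (T z, z) = |w|^2, where w is the image of z under the square root of T. *)
Lemma spectral_op_positive phi : (forall k, 0 <= phi (lam k)) ->
  positive_op dot (spectral_op dot e lam (fun s => (phi s)%:C)).
Proof.
move=> phi0 z Dz; set Tz := spectral_op _ _ _ _ z.
have TE k : dot Tz (e k) = (phi (lam k))%:C * dot z (e k) by apply: spectral_op_coef.
have [|w wE] := @dominated_coef (fun k => (Num.sqrt (phi (lam k)))%:C * dot z (e k)) Tz z.
  move=> k; rewrite TE !cmodM !cmodr !exprMn !real_normK ?num_real// sqr_sqrtr//.
  rewrite -[X in _ <= _ + X]mul1r -mulrDl; apply: ler_wpM2r; first exact: sqr_ge0.
  by have := sqr_ge0 (phi (lam k) - 1); have := phi0 k; nra.
rewrite (_ : dot Tz z = dot w w); first by rewrite (dotzz Hdot) ler0c sqr_ge0.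
apply: (dot_eq_of_coef Hdot eB) => k; rewrite TE !wE rmorphM /= conjCr.
by rewrite mulrACA -rmorphM /= -expr2 sqr_sqrtr// mulrA.
Qed.

Section Eigenbasis.
Variable B : operator H.
Hypothesis B_sa : self_adjoint dot B.
Hypothesis B_eigen : forall k, opdom B (e k) /\ B (e k) = (lam k)%:C *: e k.
Hypothesis lam_ge0 : forall k, 0 <= lam k.

Lemma operator_coef z k : opdom B z -> dot (B z) (e k) = (lam k)%:C * dot z (e k).
Proof.
move=> Dz; have [Dk Bk] := B_eigen k.
by rewrite (self_adjoint_sym B_sa)// Bk dotZr conjCr.
Qed.

(** That the square of the diagonal root is B has two halves.  On the domain of
    B the coefficients agree.  Conversely a vector in the domain of the square
    lies in the domain of the adjoint of B, which is B itself. *)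
Lemma pow_half_sqrt : is_sqrt_op dot B (pow_op dot e lam 2^-1).
Proof.
have half k : (lam k `^ 2^-1)%:C * (lam k `^ 2^-1)%:C = (lam k)%:C.
  have h2 : 2^-1 + 2^-1 = 1 :> R by lra.
  by rewrite -rmorphM /= -powRD h2 ?oner_eq0// powRr1.
split; first exact: spectral_op_self_adjoint.
  by apply: spectral_op_positive => k; exact: powR_ge0.
have DB z : opdom B z -> opdom (comp_op (pow_op dot e lam 2^-1) (pow_op dot e lam 2^-1)) z /\
    pow_op dot e lam 2^-1 (pow_op dot e lam 2^-1 z) = B z.
  move=> Dz.
  have [|w wE] := @dominated_coef (fun k => (lam k `^ 2^-1)%:C * dot z (e k)) (B z) z.
    move=> k; rewrite operator_coef// !cmodM !cmodr !exprMn !real_normK ?num_real//.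
    rewrite -[X in _ <= _ + X]mul1r -mulrDl; apply: ler_wpM2r; first exact: sqr_ge0.
    have : (lam k `^ 2^-1) * (lam k `^ 2^-1) = lam k by apply: complexI; rewrite rmorphM half.
    by have := sqr_ge0 (lam k - 1); have := lam_ge0 k; nra.
  have [D1 E1] := spectral_op_eq (f := fun s => (s `^ 2^-1)%:C) wE.
  have [D2 E2] : opdom (pow_op dot e lam 2^-1) w /\ pow_op dot e lam 2^-1 w = B z.
    by apply: spectral_op_eq => k; rewrite operator_coef// wE mulrA half.
  by rewrite -E1 in D2 E2; split; first split.
split; last by move=> z /DB[].
apply/seteqP; split=> z; last by move=> /DB[].
move=> [D1 D2].
have [_ _ sa] := B_sa; have [+ _] := sa z (pow_op dot e lam 2^-1 (pow_op dot e lam 2^-1 z)).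
case=> // u Du; apply: (dot_eq_of_coef Hdot eB) => k.
rewrite operator_coef// !spectral_op_coef// mulrA half.
by rewrite rmorphM /= conjCr mulrCA mulrA.
Qed.
End Eigenbasis.
End SpectralCalculus.

(** * Jackson's inequality *)

Lemma cmod_cis_sub1 (R : realType) (t : R) :
  cmod ((cos t +i* sin t) - 1) ^+ 2 = 2 * (1 - cos t).
Proof.
apply: complexI; rewrite rmorphXn /= cmodE -add_Re2_Im2 /=.
by congr _%:C; rewrite subr0 sin2cos2; ring.
Qed.

Lemma sum_nat_shift (V : nmodType) (F : nat -> V) n N :
  \sum_(n <= j < n + N) F j = \sum_(j < N) F (n + j)%N.
Proof.
rewrite -{1}[n]add0n big_addn addKn big_mkord.
by apply: eq_bigr => j _; rewrite addnC.
Qed.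

Section Modulus.
Variables (R : realType) (H : completeNormedModType R[i]) (dot : {dot H for Num.conj}).
Hypothesis Hdot : induces_norm dot.
Variable e : nat -> H.
Hypothesis eB : orthonormal_basis dot e.
Variable lam : nat -> R.
Implicit Types (u v w z : H) (alpha h : R).

Lemma exp_op_coef h z j :
  dot (exp_op dot e lam h z) (e j) = (cos (h * lam j) +i* sin (h * lam j)) * dot z (e j).
Proof.
apply: (spectral_op_coef Hdot eB (f := fun s => cos (h * s) +i* sin (h * s))).
apply/(spectral_op_domP Hdot eB); apply: (dominated_coef Hdot eB (u := z) (v := z)) => k.
have cis1 : cmod (cos (h * lam k) +i* sin (h * lam k)) ^+ 2 = 1.
  by apply: complexI; rewrite rmorphXn /= cmodE -add_Re2_Im2 /= cos2Dsin2.
by rewrite cmodM exprMn cis1 mul1r lerDl sqr_ge0.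
Qed.

Lemma diff_op_coef h k z j : cmod (dot (diff_op dot e lam h k z) (e j)) ^+ 2 =
  2 ^+ k * (1 - cos (h * lam j)) ^+ k * cmod (dot z (e j)) ^+ 2.
Proof.
elim: k => [|k IH]; first by rewrite !expr0 !mul1r.
rewrite /diff_op /= -/(diff_op _ _ _ _ _ _) dotBl exp_op_coef -[X in _ - X]mul1r -mulrBl.
by rewrite cmodM exprMn cmod_cis_sub1 IH !exprS; ring.
Qed.

Lemma hnorm_diff_op_le h k z : hnorm (diff_op dot e lam h k z) <= 2 ^+ k * hnorm z.
Proof.
apply: (hnorm_le_of_coef Hdot eB) => [|n].
  by rewrite mulr_ge0 ?exprn_ge0// hnorm_ge0.
rewrite exprMn; apply: le_trans (ler_wpM2l _ (bessel Hdot eB z n)); last exact: sqr_ge0.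
rewrite mulr_sumr; apply: ler_sum => j _; rewrite diff_op_coef.
apply: ler_wpM2r; first exact: sqr_ge0.
by rewrite expr2 ler_wpM2l ?exprn_ge0// pow_one_sub_cos_le.
Qed.

(** The set whose supremum is omega is bounded, by hnorm_diff_op_le. *)
Lemma hnorm_diff_op_le_omega (t tau : R) k z : 0 < tau <= t ->
  hnorm (diff_op dot e lam tau k z) <= omega dot e lam k t z.
Proof.
move=> tt; apply: ub_le_sup; last by exists tau.
by exists (2 ^+ k * hnorm z) => _ [h _ <-]; exact: hnorm_diff_op_le.
Qed.

Lemma omega_ge0 (t : R) k z : 0 < t -> 0 <= omega dot e lam k t z.
Proof.
move=> t0; apply: le_trans (hnorm_ge0 _) (hnorm_diff_op_le_omega k z (tau := t) _).
by rewrite t0 lexx.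
Qed.

(** For each tau in (0, pi / lam n] Bessel's inequality bounds the tail of the
    squared coefficients of Delta_tau^k z by omega^2.  With tau = t / lam n and
    the frequency ratios s j = lam (n+j) / lam n >= 1, averaging over t gives
    the claim. *)
Lemma jackson (k n N : nat) z : (0 < k)%N -> 0 < lam n ->
  (forall j, (n <= j)%N -> lam n <= lam j) ->
  \sum_(n <= j < n + N) cmod (dot z (e j)) ^+ 2 <=
    (Num.sqrt k.+1%:R / 2 ^+ k * omega dot e lam k (pi / lam n) z) ^+ 2.
Proof.
case: k => // k _ ln0 lamn; set om := omega _ _ _ _ _ _.
have om0 : 0 <= om by apply: omega_ge0; rewrite divr_gt0 ?pi_gt0.
pose s j := lam (n + j)%N / lam n.
pose a j := 2 ^+ k.+1 * cmod (dot z (e (n + j)%N)) ^+ 2.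
rewrite sum_nat_shift; set X := \sum_(j < N) _.
suff hX : 2 ^+ k.+1 * X * (2 ^+ k.+1 / k.+2%:R) <= om ^+ 2.
  rewrite exprMn expr_div_n sqr_sqrtr//.
  have p0 : 0 < 2 ^+ k.+1 :> R by rewrite exprn_gt0.
  have r0 : 0 < k.+2%:R :> R by [].
  move: (2 ^+ k.+1) (k.+2%:R) p0 r0 hX => p r p0 r0 hX.
  have -> : X = r / p ^+ 2 * (p * X * (p / r)) by field; rewrite !lt0r_neq0.
  by apply: ler_wpM2l hX; rewrite divr_ge0 ?sqr_ge0 ?ltW.
rewrite mulr_sumr mulr_suml.
apply: (@sum_le_of_trig_bound R N k s a (om ^+ 2)).
- by move=> j _; rewrite ler_pdivlMr// mul1r lamn// leq_addr.
- by move=> j; rewrite mulr_ge0 ?exprn_ge0// cmod_ge0.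
move=> t /andP[t0 tpi].
have tt : 0 < t / lam n <= pi / lam n by rewrite divr_gt0//= ler_pM2r// invr_gt0.
have hd := hnorm_diff_op_le_omega k.+1 z tt.
apply: (@le_trans _ _ (hnorm (diff_op dot e lam (t / lam n) k.+1 z) ^+ 2)); last first.
  by rewrite ler_pXn2r ?nnegrE ?hnorm_ge0.
set Dz := diff_op _ _ _ _ _ _.
apply: le_trans (bessel Hdot eB _ (n + N)).
rewrite (big_cat_nat (leq0n n) (leq_addr N n)) /=.
rewrite -[X in X <= _]add0r; apply: lerD; first by apply: sumr_ge0 => j _; exact: sqr_ge0.
rewrite sum_nat_shift; apply: ler_sum => j _; rewrite /Dz diff_op_coef /a /s mulrAC.
by have -> : lam (n + j)%N / lam n * t = t / lam n * lam (n + j)%N by rewrite mulrC mulrCA mulrC.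
Qed.
End Modulus.

(** The Ritz functional is the squared energy distance to x, up to a constant
    independent of the argument. *)
Lemma energy_norm_ritz_le (R : realType) (H : completeNormedModType R[i])
    (dot : {dot H for Num.conj}) (A : operator H) (e : nat -> H) n (x xn z : H) :
  self_adjoint dot A -> (forall i, opdom A (e i)) -> opdom A x ->
  ritz_solution dot A (A x) e n xn -> Defs.span (fun i : 'I_n => e i) z ->
  energy_norm dot A (x - xn) <= energy_norm dot A (x - z).
Proof.
move=> Asa De Dx [Hxn xnmin] Hz; have LA : linear_op A by case: Asa.
have Dspan v : Defs.span (fun i : 'I_n => e i) v -> opdom A v.
  move=> [c ->]; have [D0 DL] := LA.
  elim/big_rec: _ => // i u _ Du.
  by have [] := DL (c i) (e i) u (De i) Du.
have energyE v : opdom A v -> complex.Re (dot (A (x - v)) (x - v)) =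
    complex.Re (dot (A x) x) + ritz_functional dot A (A x) v.
  move=> Dv; have [_ ->] := linear_opB LA Dx Dv.
  rewrite dotBl !dotBr (self_adjoint_sym Asa Dv Dx) [dot v (A x)]dotC.
  rewrite /ritz_functional; case: (dot (A x) x) => a b; case: (dot (A x) v) => c d.
  by case: (dot (A v) v) => c' d' /=; ring.
by apply: ler_wsqrtr; rewrite !energyE ?lerD2l; [exact: xnmin|exact: Dspan|exact: Dspan].
Qed.

(** * The error estimate *)

Lemma pd_op_inj (R : realType) (H : normedModType R[i]) (dot : {dot H for Num.conj})
    (C : operator H) z : positive_definite dot C -> opdom C z -> C z = 0 -> z = 0.
Proof.
move=> [g g0 Cg] Dz Cz; have := Cg _ Dz; rewrite Cz dot0l -hnormE -rmorphXn -rmorphM lecR.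
rewrite pmulr_rle0// => hz; apply/eqP; rewrite -hnorm_eq0 -sqrf_eq0.
by rewrite eq_le hz sqr_ge0.
Qed.

Lemma sqrt_op_inj (R : realType) (H : completeNormedModType R[i])
    (dot : {dot H for Num.conj}) (Hdot : induces_norm dot) (C S : operator H) z :
  positive_definite dot C -> is_sqrt_op dot C S -> opdom S z -> S z = 0 -> z = 0.
Proof.
move=> Cpd [[SL _ _] _ [SC SE]] Dz Sz.
have Cz : opdom C z by rewrite -SC; split=> //=; rewrite Sz; case: SL.
by apply: (pd_op_inj Cpd Cz); rewrite -SE //= Sz linear_op0.
Qed.

Section Tail.
Variables (R : realType) (H : completeNormedModType R[i]) (dot : {dot H for Num.conj}).
Hypothesis Hdot : induces_norm dot.
Variable e : nat -> H.
Hypothesis eB : orthonormal_basis dot e.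
Variable lam : nat -> R.

(** Beyond n, one has lam j ^ (1/2) <= lam j ^ alpha / lam n ^ (alpha - 1/2),
    since the eigenvalues increase and alpha >= 1/2. *)
Lemma hnorm_sqrt_tail_le (alpha : R) (x : H) (k n : nat) :
  1 <= alpha -> (0 < k)%N -> 0 < lam n -> (forall j, (n <= j)%N -> lam n <= lam j) ->
  opdom (pow_op dot e lam alpha) x ->
  let w := x - \sum_(0 <= j < n) dot x (e j) *: e j in
  opdom (pow_op dot e lam 2^-1) w ->
  hnorm (pow_op dot e lam 2^-1 w) <=
    Num.sqrt k.+1%:R / (2 ^+ k * lam n `^ (alpha - 2^-1))
      * omega dot e lam k (pi / lam n) (pow_op dot e lam alpha x).
Proof.
move=> alpha1 k0 ln0 lamn Dx w Dw.
set om := omega _ _ _ _ _ _; set Bx := pow_op dot e lam alpha x.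
have om0 : 0 <= om by apply: (omega_ge0 Hdot eB); rewrite divr_gt0 ?pi_gt0.
set q := lam n `^ (alpha - 2^-1); have q0 : 0 < q by exact: powR_gt0.
have -> : Num.sqrt k.+1%:R / (2 ^+ k * q) * om = q^-1 * (Num.sqrt k.+1%:R / 2 ^+ k * om).
  by rewrite invfM; ring.
apply: (hnorm_le_of_coef Hdot eB) => [|N].
  by rewrite mulr_ge0 ?invr_ge0 ?(ltW q0)// mulr_ge0 ?divr_ge0 ?sqrtr_ge0 ?exprn_ge0.
have coefw j : dot w (e j) = if (j < n)%N then 0 else dot x (e j).
  rewrite /w dotBl (dot_sum_basis eB) /=; case: ifP => _; first exact: subrr.
  exact: subr0.
have coefT j : dot (pow_op dot e lam 2^-1 w) (e j) = (lam j `^ 2^-1)%:C * dot w (e j).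
  exact: (spectral_op_coef Hdot eB _ Dw).
have coefB j : dot Bx (e j) = (lam j `^ alpha)%:C * dot x (e j).
  exact: (spectral_op_coef Hdot eB _ Dx).
apply: (@le_trans _ _ (\sum_(0 <= j < n + N) cmod (dot (pow_op dot e lam 2^-1 w) (e j)) ^+ 2)).
  rewrite [(n + N)%N]addnC [leRHS](big_cat_nat (leq0n N) (leq_addr n N)) /= lerDl.
  by apply: sumr_ge0 => j _; exact: sqr_ge0.
rewrite (big_cat_nat (leq0n n) (leq_addr N n)) /= big_nat big1 ?add0r => [|j /= jn].
  rewrite exprMn; apply: le_trans (ler_wpM2l _ (jackson Hdot eB N Bx k0 ln0 lamn)); last first.
    exact: sqr_ge0.
  rewrite mulr_sumr !big_nat; apply: ler_sum => j /andP[nj _].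
  rewrite coefT coefB coefw ltnNge nj /= !cmodM !cmodr !exprMn [leRHS]mulrA.
  apply: ler_wpM2r; first exact: sqr_ge0.
  rewrite -exprMn; apply: lerXn2r; rewrite ?nnegrE ?mulr_ge0 ?invr_ge0 ?(ltW q0)//.
  rewrite !ger0_norm ?powR_ge0// ler_pdivlMl//.
  have lj0 : 0 < lam j by exact: lt_le_trans (lamn j nj).
  have -> : lam j `^ alpha = lam j `^ (alpha - 2^-1) * lam j `^ 2^-1.
    by rewrite -powRD ?subrK// (gt_eqF lj0) implybT.
  apply: ler_wpM2r; first exact: powR_ge0.
  by apply: ge0_ler_powR; rewrite ?nnegrE ?lamn ?(ltW ln0) ?(ltW lj0)//; lra.
by rewrite coefT coefw jn mulr0 (cmodr 0) normr0 expr0n.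
Qed.
End Tail.

Unset Implicit Arguments.

Theorem theorem1p3 (R : realType) (H : completeNormedModType R[i])
    (dot : {dot H for Num.conj}) (Hdot : induces_norm dot)
    (Hsep : separable H)
    (A B : operator H)
    (A_sa : self_adjoint dot A) (A_pd : positive_definite dot A)
    (B_sa : self_adjoint dot B) (B_pd : positive_definite dot B)
    (domAB : opdom A = opdom B)
    (A_disc : discrete_spectrum A) (B_disc : discrete_spectrum B)
    (* lam k and e k stand for $\lambda_{k+1}$ and $e_{k+1}$ *)
    (lam : nat -> R) (e : nat -> H)
    (lam_incr : forall k, lam k < lam k.+1)
    (B_spec : spectrum B = [set (lam k)%:C | k in setT])
    (B_simple : forall k, simple_eigenvalue B (lam k)%:C)
    (e_basis : orthonormal_basis dot e)
    (e_eigen : forall k, opdom B (e k) /\ B (e k) = (lam k)%:C *: e k)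
    (sqrtA : operator H) (HsqrtA : is_sqrt_op dot A sqrtA)
    (x y : H) (x_dom : opdom A x) (Axy : A x = y)
    (alpha : R) (alpha_ge1 : 1 <= alpha)
    (x_smooth : opdom (pow_op dot e lam alpha) x)
    (k n : nat) (k_gt0 : (0 < k)%N) (n_gt0 : (0 < n)%N)
    (xn : H) (Hxn : ritz_solution dot A y e n xn) :
  let sqrtB := pow_op dot e lam 2^-1 in
  let c2 := opnorm (comp_op sqrtA (inv_op sqrtB)) in
  let c3 := opnorm (comp_op sqrtB (inv_op sqrtA))
            * opnorm (comp_op sqrtA (inv_op sqrtB)) in
  let c0 := c2 * c3 in
  energy_norm dot A (x - xn)
    <= c0 * (Num.sqrt k.+1%:R / (2 ^+ k * lam n `^ (alpha - 2^-1)))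
       * omega dot e lam k (pi / lam n) (pow_op dot e lam alpha x).
Proof.
cbv zeta; set sqrtB := pow_op dot e lam 2^-1.
set c2 := opnorm (comp_op sqrtA (inv_op sqrtB)).
set M := opnorm (comp_op sqrtB (inv_op sqrtA)).
have lam_pos j : 0 < lam j.
  have [Dj Bj] := e_eigen j; have [g g0 Bg] := B_pd.
  have := Bg _ Dj; rewrite Bj dotZl e_basis.1 eqxx mulr1 lecE => /andP[_]; apply: lt_le_trans.
  rewrite -hnormE -rmorphXn -rmorphM /= (hnorm_sqr Hdot) e_basis.1 eqxx /= mulr1.
  exact: g0.
have lam_mono : forall j, (n <= j)%N -> lam n <= lam j.
  move=> j nj; rewrite -(subnKC nj); elim: (j - n)%N => [|m IH]; first by rewrite addn0.
  by apply: le_trans IH _; rewrite addnS ltW.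
have Asurj := surjective_of_discrete_pd A_pd A_disc.
have Bsurj := surjective_of_discrete_pd B_pd B_disc.
have HsqrtB : is_sqrt_op dot B sqrtB.
  exact: (pow_half_sqrt Hdot e_basis B_sa e_eigen (fun j => ltW (lam_pos j))).
have [CA hCA] := heinz Hdot A_sa B_sa B_pd domAB Bsurj HsqrtA HsqrtB.
have [CB hCB] := heinz Hdot B_sa A_sa A_pd (esym domAB) Asurj HsqrtB HsqrtA.
have [[LA _ _] _ _] := HsqrtA; have [[LB _ _] _ _] := HsqrtB.
have bA := opnorm_comp_inv LB LA (fun z => sqrt_op_inj Hdot B_pd HsqrtB (z := z))
  (fun z DB DA => hCA z DA DB).
have bB := opnorm_comp_inv LA LB (fun z => sqrt_op_inj Hdot A_pd HsqrtA (z := z))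
  (fun z DA DB => hCB z DB DA).
rewrite -/c2 in bA; rewrite -/M in bB.
have e0D : opdom B (e 0) := (e_eigen 0).1.
have [De0A _ _] : [/\ opdom sqrtA (e 0), opdom sqrtA (sqrtA (e 0)) & sqrtA (sqrtA (e 0)) = A (e 0)].
  by apply: (sqrt_op_dom HsqrtA); rewrite domAB.
have [De0B _ _] := sqrt_op_dom HsqrtB e0D.
have e0B : 0 < hnorm (sqrtB (e 0)).
  rewrite lt_neqAle hnorm_ge0 andbT eq_sym hnorm_eq0; apply/eqP => Be0.
  have := sqrt_op_inj Hdot B_pd HsqrtB De0B Be0.
  move=> e00; have := e_basis.1 0%N 0%N; rewrite e00 dot0l eqxx => /eqP.
  by rewrite eq_sym oner_eq0.
have c20 : 0 <= c2.
  by rewrite -(pmulr_lge0 _ e0B); apply: le_trans (bA _ De0B De0A); exact: hnorm_ge0.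
(* From T to S and back on the nonzero vector e 0. *)
have c3_ge1 : 1 <= M * c2.
  have M0 : 0 <= M.
    have e0A : 0 < hnorm (sqrtA (e 0)).
      rewrite lt_neqAle hnorm_ge0 andbT eq_sym hnorm_eq0; apply/eqP => Ae0.
      by have := bB _ De0A De0B; rewrite Ae0 hnorm0 mulr0 leNgt e0B.
    by rewrite -(pmulr_lge0 _ e0A); apply: le_trans (bB _ De0A De0B); exact: hnorm_ge0.
  rewrite -(ler_pM2r e0B) mul1r -mulrA; apply: le_trans (bB _ De0A De0B) _.
  by apply: ler_wpM2l => //; exact: bA.
pose p := \sum_(0 <= j < n) dot x (e j) *: e j.
have DB0 : opdom B p.
  have [[D0 DL] _ _] := B_sa; rewrite /p; elim: (n) => [|m IH]; first by rewrite big_geq.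
  by rewrite big_nat_recr//= addrC; have [] := DL (dot x (e m)) _ _ (e_eigen m).1 IH.
have LopB : linear_op B by case: B_sa.
have DBw : opdom B (x - p).
  by have [] := linear_opB LopB (u := x) (v := p) _ DB0; rewrite -?domAB.
have DAw : opdom A (x - p) by rewrite domAB.
have [DwB _ _] := sqrt_op_dom HsqrtB DBw; have [DwA _ _] := sqrt_op_dom HsqrtA DAw.
have pspan : Defs.span (fun i : 'I_n => e i) p.
  by exists (fun i : 'I_n => dot x (e i)); rewrite /p big_mkord.
have Ritz : energy_norm dot A (x - xn) <= energy_norm dot A (x - p).
  apply: energy_norm_ritz_le A_sa _ x_dom _ pspan; last by rewrite Axy.
  by move=> i; rewrite domAB; case: (e_eigen i).
apply: le_trans Ritz _.
rewrite /energy_norm -(sqrt_op_form Hdot HsqrtA DAw) sqrtr_sqr ger0_norm ?hnorm_ge0//.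
apply: le_trans (bA _ DwB DwA) _.
have tail := hnorm_sqrt_tail_le Hdot e_basis alpha_ge1 k_gt0 (lam_pos n) lam_mono x_smooth DwB.
rewrite -[leRHS]mulrA -[leRHS]mulrA; apply: ler_wpM2l => //.
apply: le_trans tail _; rewrite ler_peMl// mulr_ge0//.
  by rewrite divr_ge0 ?sqrtr_ge0// mulr_ge0 ?exprn_ge0// powR_ge0.
by apply: (omega_ge0 Hdot e_basis); rewrite divr_gt0 ?pi_gt0.
Qed.
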